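(* Let a program of the language Guard (Spawn extended with guarded statements) be given, with procedure table $\overline M$ and main block $s_{main}$, and let $q_{ini}=\mathrm{push}(\mathrm{create}(),K(s_{main}))$. Assume that statements are disambiguated (e.g. by tagging them with their code position) so that the following hold for all states $\sigma$ and statements $s_1,s_2,s$: (i) if $pc\triangleright\tau\cdot K(s_1')\in\mathrm{val}_\sigma(s_1)$ and $pc'\triangleright\tau'\cdot K(s_2')\in\mathrm{val}_\sigma(s_2)$ with $s_1',s_2'$ non-empty and $s_1\ne s_2$, then $s_1'\neq s_2'$; (ii) if $pc\triangleright\tau\cdot K(s')\in\mathrm{val}_\sigma(s)$ with $s'$ non-empty, then there is no procedure $m$ with $m(x)\{s'\}\in\overline M$. Then the scheduler defined by the transition relation $\to_S$ (rules (S6)--(S8) and (S10)) is a weakly fair scheduler for the semantics $\to$ (rules (R4)--(R5)): if $$\langle\sigma_\varepsilon\rangle,\,q_{ini}\ \to_S\ sh_1,\,q_1\ \to_S\ sh_2,\,q_2\ \to_S\ \cdots$$ is a (finite or infinite) scheduler execution, then there is a weakly fair execution $$\langle\sigma_\varepsilon\rangle,\,\{K(s_{main})\}\ \to^*\ sh_1,\,\mathrm M(q_1)\ \to^*\ sh_2,\,\mathrm M(q_2)\ \to^*\ \cdots$$ in the semantics $\to$, which produces the same trace. Here $\to^*$ is the reflexive transitive closure of $\to$.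
   Context: **Syntax.** Statements: $s ::= \mathsf{skip}\mid v:=e\mid \mathsf{if}\ e\,\{s\}\mid s;s\mid \mathsf{while}\ e\,\{s\}\mid \mathsf{spawn}(m,e)\mid (::g;s)$, with $g$ a Boolean expression. Expressions are side-effect free and well-typed, so evaluation never gets stuck. A program consists of a finite set $\overline M$ of procedure declarations $m(x)\{s\}$ (name $m$, one local parameter $x$, body $s$; one declaration per name) and a main block $s_{main}$. Spawned procedures are declared. $\bot$ denotes the empty statement; $\bot;s$ is always rewritten to $s$. **States and traces.** A state $\sigma$ is a partial map from variables to values; $\mathrm{val}_\sigma(e)$ is the value of $e$ in $\sigma$; $\sigma[x\mapsto v]$ is update; $\sigma\subseteq\sigma'$ means $\sigma'$ extends $\sigma$. $\sigma_\varepsilon$ initialises all program variables to $0$. A trace is a finite or infinite sequence of states and event markers $callEv(m,v)$, $callREv(m,v)$ ($\varepsilon$ empty trace, $\tau\frown t$ appending, $\cdot$ concatenation, $\langle\sigma\rangle=\varepsilon\frown\sigma$, $\mathrm{last}(\tau)$ final state). For an event $ev$ put $ev_\sigma(\bar v)=\langle\sigma\rangle\frown ev(\bar v)\frown\sigma$. Chop: if $\tau_1=\tau\frown\sigma$ is finite, $\tau_2=\langle\sigma'\rangle\cdot\tau'$, $\sigma\subseteq\sigma'$, then $\tau_1**\tau_2=\tau\cdot\tau_2$. A path condition $pc$ is a finite set of truth values, consistent if it does not contain false. **Well-formedness.** $wf(\varepsilon)$ holds; $wf(sh\frown\sigma)=wf(sh)$; $wf(sh\frown callEv(m,v))=wf(sh)$;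 $wf(sh\frown callREv(m,v))$ iff $wf(sh)$ and $\#_{sh}(callEv(m,v))>\#_{sh}(callREv(m,v))$, where $\#_{sh}$ counts occurrences in $sh$. **Local evaluation.** $\mathrm{val}_\sigma(s)$ is a set of items $pc\triangleright\tau\cdot K(s')$ with continuation $K(s')$: $\mathrm{val}_\sigma(\bot)=\emptyset$; $\mathrm{val}_\sigma(\mathsf{skip})=\{\emptyset\triangleright\langle\sigma\rangle\cdot K(\bot)\}$; $\mathrm{val}_\sigma(x:=e)=\{\emptyset\triangleright\langle\sigma\rangle\frown\sigma[x\mapsto\mathrm{val}_\sigma(e)]\cdot K(\bot)\}$; $\mathrm{val}_\sigma(\mathsf{if}\ e\{s\})=\{\{\mathrm{val}_\sigma(e)\}\triangleright\langle\sigma\rangle\cdot K(s),\ \{\mathrm{val}_\sigma(!e)\}\triangleright\langle\sigma\rangle\cdot K(\bot)\}$; $\mathrm{val}_\sigma(r;s)=\{pc\triangleright\tau\cdot K(r';s)\mid pc\triangleright\tau\cdot K(r')\in\mathrm{val}_\sigma(r)\}$; $\mathrm{val}_\sigma(\mathsf{while}\ e\{s\})=\mathrm{val}_\sigma(\mathsf{if}\ e\{s;\mathsf{while}\ e\{s\}\})$; $\mathrm{val}_\sigma(\mathsf{spawn}(m,e))=\{\emptyset\triangleright callEv_\sigma(m,\mathrm{val}_\sigma(e))\cdot K(\bot)\}$; $\mathrm{val}_\sigma(::g;s)=\{\{\mathrm{val}_\sigma(g)\}\triangleright\langle\sigma\rangle\cdot K(s)\}$. **Semantics $\to$.** Configurations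 $sh,p$ with $p$ a multiset of continuations, from which $K(\bot)$ is always deleted. (R4) If $\sigma=\mathrm{last}(sh)$, $pc\triangleright\tau\cdot K(s')\in\mathrm{val}_\sigma(s)$, $pc$ consistent: $sh,\,p\uplus\{K(s)\}\to sh**\tau,\,p\uplus\{K(s')\}$. (R5) If $m(x)\{s\}\in\overline M$, $\sigma=\mathrm{last}(sh)$, $wf(sh**callREv_\sigma(m,v))$, $y\notin\mathrm{dom}(\sigma)$: $sh,\,p\to sh**callREv_\sigma(m,v)\frown\sigma[y\mapsto v],\,p\uplus\{K(s[x\leftarrow y])\}$. **Scheduler $\to_S$.** Configurations $sh,q$ with $q$ a FIFO queue of continuations: $\mathrm{create}()$ is the empty queue, $\mathrm{push}(q,k)$ adds $k$ at the rear, $\mathrm{pop}(q)=(q',k)$ returns the first element $k$ and the rest $q'$ (undefined if $q$ is empty), $\mathrm{rotate}(q)=\mathrm{push}(q',k)$ for $(q',k)=\mathrm{pop}(q)$. Put $\sigma=\mathrm{last}(sh)$ and let (U) be the condition: for no declared procedure $m$ and no value $v$ does $wf(sh**callREv_\sigma(m,v))$ hold. (S6) If $\mathrm{pop}(q)=(q',K(s))$, $pc\triangleright\tau\cdot K(s')\in\mathrm{val}_\sigma(s)$, $pc$ consistent, and (U): $sh,q\to_S sh**\tau,\mathrm{push}(q',K(s'))$. (S7) If $m(x)\{s\}\in\overline M$, $wf(sh**callREv_\sigma(m,v))$, $y\notin\mathrm{dom}(\sigma)$: $sh,q\to_S sh**callREv_\sigma(m,v)\frown\sigma[y\mapsto v],\mathrm{push}(q,K(s[x\leftarrow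 y]))$. (S8) If $\mathrm{pop}(q)=(q',K(\bot))$ and (U): $sh,q\to_S sh,q'$. (S10) If $\mathrm{pop}(q)=(q',K(s))$, $s\ne\bot$, (U), and there is no $pc\triangleright\tau\cdot K(s')\in\mathrm{val}_\sigma(s)$ with $pc$ consistent: $sh,q\to_S sh,\mathrm{rotate}(q)$. $\mathrm M(q)$ is the multiset of non-empty continuations ($\neq K(\bot)$) in $q$. **Weak fairness.** For $C=(sh,p)\to C'=(sh',p')$, $\mathrm{newStmt}(C,C')=p'-p$ (multiset difference); $\mathrm{enabled}(C)$ is the multiset of all continuations in $\mathrm{newStmt}(C,C')$ over all $C'$ with $C\to C'$. An infinite execution $C_0\to C_1\to\cdots$ is weakly fair if for all $m$ and all $K(s)$: if $K(s)\in\mathrm{enabled}(C_n)$ for every $n\ge m$, then $K(s)\in\mathrm{newStmt}(C_{n'},C_{n'+1})$ for some $n'\ge m$. Fairness imposes no requirement on finite (terminating or stuck) executions. *)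

(* Defs.v *)
From HB Require Import structures.
From Stdlib Require Import Relation_Operators.
From mathcomp Require Import all_boot.
From mathcomp Require Import finmap multiset boolp.

Set Implicit Arguments.
Unset Strict Implicit.
Unset Printing Implicit Defensive.

Local Open Scope fset_scope.
Local Open Scope fmap_scope.
Local Open Scope mset_scope.
Local Open Scope nat_scope.

(* Program variables and procedure names are drawn from a countably infinite
   set of identifiers. *)
Notation var := nat (only parsing).
Notation pname := nat (only parsing).

(* The base signature is a parameter: data values with a distinguished value 0,
   and totally interpreted operation and relation symbols, so that evaluation
   never gets stuck. [tag] is the type of the labels that disambiguate
   statements (e.g. code positions). *)
Record signature := Signature {
  value : Type;
  zero : value;
  op : Type;
  op_sem : op -> seq value -> value;
  rel_sym : Type;
  rel_sem : rel_sym -> seq value -> bool;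
  tag : Type
}.

Section Syntax.
Variable L : signature.

Inductive expr :=
| EVar (x : var)
| EOp (f : op L) (es : seq expr).

Inductive bexpr :=
| BRel (r : rel_sym L) (es : seq expr)
| BNot (b : bexpr)
| BAnd (b1 b2 : bexpr).

(* Non-empty statements: the empty statement is not part of the grammar, and
   is [None] in the continuations [option stmt] below. Tags have no effect on
   the semantics, but statements with different tags are different. *)
Inductive stmt :=
| Skip (t : tag L)
| Assign (t : tag L) (x : var) (e : expr)
| If (t : tag L) (b : bexpr) (s : stmt)
| Seq (s1 s2 : stmt)
| While (t : tag L) (b : bexpr) (s : stmt)
| Spawn (t : tag L) (m : pname) (e : expr)
| Guard (t : tag L) (g : bexpr) (s : stmt).

Definition ren (x y z : var) : var := if z == x then y else z.

Fixpoint expr_subst (x y : var) (e : expr) : expr :=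
  match e with
  | EVar z => EVar (ren x y z)
  | EOp f es => EOp f (map (expr_subst x y) es)
  end.

Fixpoint bexpr_subst (x y : var) (b : bexpr) : bexpr :=
  match b with
  | BRel r es => BRel r (map (expr_subst x y) es)
  | BNot b => BNot (bexpr_subst x y b)
  | BAnd b1 b2 => BAnd (bexpr_subst x y b1) (bexpr_subst x y b2)
  end.

(* s[x <- y]: every occurrence of x is replaced, assigned ones included. *)
Fixpoint subst (x y : var) (s : stmt) : stmt :=
  match s with
  | Skip t => Skip t
  | Assign t z e => Assign t (ren x y z) (expr_subst x y e)
  | If t b s => If t (bexpr_subst x y b) (subst x y s)
  | Seq s1 s2 => Seq (subst x y s1) (subst x y s2)
  | While t b s => While t (bexpr_subst x y b) (subst x y s)
  | Spawn t m e => Spawn t m (expr_subst x y e)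
  | Guard t g s => Guard t (bexpr_subst x y g) (subst x y s)
  end.

Fixpoint expr_vars (e : expr) : seq var :=
  match e with
  | EVar x => [:: x]
  | EOp _ es => flatten (map expr_vars es)
  end.

Fixpoint bexpr_vars (b : bexpr) : seq var :=
  match b with
  | BRel _ es => flatten (map expr_vars es)
  | BNot b => bexpr_vars b
  | BAnd b1 b2 => bexpr_vars b1 ++ bexpr_vars b2
  end.

Fixpoint stmt_vars (s : stmt) : seq var :=
  match s with
  | Skip _ => [::]
  | Assign _ x e => x :: expr_vars e
  | If _ b s | While _ b s | Guard _ b s => bexpr_vars b ++ stmt_vars s
  | Seq s1 s2 => stmt_vars s1 ++ stmt_vars s2
  | Spawn _ _ e => expr_vars e
  end.

Fixpoint spawned (s : stmt) : seq pname :=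
  match s with
  | Skip _ | Assign _ _ _ => [::]
  | If _ _ s | While _ _ s | Guard _ _ s => spawned s
  | Seq s1 s2 => spawned s1 ++ spawned s2
  | Spawn _ m _ => [:: m]
  end.

Definition state := {fmap var -> value L}.

Inductive item :=
| St (sigma : state)
| CallEv (m : pname) (v : value L)
| CallREv (m : pname) (v : value L).

(* Configurations only contain finite traces; infinite traces arise as the
   traces produced by infinite executions, see [produced] below. *)
Definition trace := seq item.

End Syntax.

Arguments EVar {L} x.
Arguments CallEv {L} m v.
Arguments CallREv {L} m v.

(* Classical decidable equality and choice, needed for multisets, counting and
   list membership. *)
HB.instance Definition _ (L : signature) := gen_eqMixin (stmt L).
HB.instance Definition _ (L : signature) := gen_choiceMixin (stmt L).
HB.instance Definition _ (L : signature) := gen_eqMixin (item L).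

Record program (L : signature) := Program {
  procs : seq (pname * var * stmt L);   (* (m, x, s) stands for m(x){s} *)
  main : stmt L;
  procs_uniq : uniq [seq d.1.1 | d <- procs];
  spawned_declared : forall m : pname,
    m \in spawned main ++ flatten [seq spawned d.2 | d <- procs] ->
    m \in [seq d.1.1 | d <- procs]
}.

Section Semantics.
Variable L : signature.

(* The default for variables outside the domain only makes evaluation total:
   [sigma_eps] is defined on all program variables, and domains only grow. *)
Fixpoint eval (sigma : state L) (e : expr L) : value L :=
  match e with
  | EVar x => odflt (zero L) sigma.[? x]
  | EOp f es => op_sem f (map (eval sigma) es)
  end.

Fixpoint beval (sigma : state L) (b : bexpr L) : bool :=
  match b with
  | BRel r es => rel_sem r (map (eval sigma) es)
  | BNot b => ~~ beval sigma b
  | BAnd b1 b2 => beval sigma b1 && beval sigma b2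
  end.

Definition extends (sigma sigma' : state L) : Prop :=
  forall x v, sigma.[? x] = Some v -> sigma'.[? x] = Some v.

Definition last_state (sh : trace L) : option (state L) :=
  if ohead (rev sh) is Some (St sigma) then Some sigma else None.

Definition callEv (sigma : state L) m v : trace L :=
  [:: St sigma; CallEv m v; St sigma].
Definition callREv (sigma : state L) m v : trace L :=
  [:: St sigma; CallREv m v; St sigma].

(* [chop t1 t2 t]: the chop t1 ** t2 is defined and equal to t. *)
Inductive chop : trace L -> trace L -> trace L -> Prop :=
| Chop tau sigma sigma' tau' : extends sigma sigma' ->
    chop (rcons tau (St sigma)) (St sigma' :: tau') (tau ++ St sigma' :: tau').

Inductive wf : trace L -> Prop :=
| wf_eps : wf [::]
| wf_state sh sigma : wf sh -> wf (rcons sh (St sigma))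
| wf_call sh m v : wf sh -> wf (rcons sh (CallEv m v))
| wf_callR sh m v : wf sh ->
    count_mem (CallREv m v) sh < count_mem (CallEv m v) sh ->
    wf (rcons sh (CallREv m v)).

(* K(s) is [Some s] for non-empty s, and K(bot) is [None]. *)
Definition cont := option (stmt L).

Definition pathcond := {fset bool}.
Definition consistent (pc : pathcond) : bool := false \notin pc.

(* K(r; s), with bot; s rewritten to s. *)
Definition seq_cont (k : cont) (s : stmt L) : cont :=
  if k is Some r then Some (Seq r s) else Some s.

Definition val_if (sigma : state L) (b : bexpr L) (s : stmt L) :
    seq (pathcond * trace L * cont) :=
  [:: ([fset beval sigma b], [:: St sigma], Some s);
      ([fset beval sigma (BNot b)], [:: St sigma], None)].

Fixpoint val_stmt (sigma : state L) (s : stmt L) :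
    seq (pathcond * trace L * cont) :=
  match s with
  | Skip _ => [:: (fset0, [:: St sigma], None)]
  | Assign _ x e =>
      [:: (fset0, [:: St sigma; St sigma.[x <- eval sigma e]], None)]
  | If _ b s => val_if sigma b s
  | Seq r s => [seq (i.1, seq_cont i.2 s) | i <- val_stmt sigma r]
  | While t b s => val_if sigma b (Seq s (While t b s))
  | Spawn _ m e => [:: (fset0, callEv sigma m (eval sigma e), None)]
  | Guard _ g s => [:: ([fset beval sigma g], [:: St sigma], Some s)]
  end.

Definition val (sigma : state L) (k : cont) :
    seq (pathcond * trace L * cont) :=
  if k is Some s then val_stmt sigma s else [::].

Variable P : program L.

(* Pools of continuations never contain K(bot). *)
Definition pool := {mset stmt L}.
Definition conf := (trace L * pool)%type.

Definition pool_add (p : pool) (k : cont) : pool :=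
  if k is Some s then p `+` [mset s] else p.

Inductive step : conf -> conf -> Prop :=
| step_local sh sh' p sigma s pc tau k :
    last_state sh = Some sigma ->
    (pc, tau, k) \in val sigma (Some s) ->
    consistent pc ->
    chop sh tau sh' ->
    step (sh, p `+` [mset s]) (sh', pool_add p k)
| step_call sh sh' p sigma m x s v y :
    (m, x, s) \in procs P ->
    last_state sh = Some sigma ->
    chop sh (callREv sigma m v) sh' ->
    wf sh' ->
    y \notin domf sigma ->
    step (sh, p) (rcons sh' (St sigma.[y <- v]), p `+` [mset subst x y s]).

Definition queue := seq cont.
Definition create : queue := [::].
Definition push (q : queue) (k : cont) : queue := rcons q k.
Definition pop (q : queue) : option (queue * cont) :=
  if q is k :: q' then Some (q', k) else None.
(* Only used on non-empty queues. *)
Definition rotate (q : queue) : queue :=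
  if pop q is Some (q', k) then push q' k else q.

Definition sconf := (trace L * queue)%type.

(* No spawned call is waiting to be started. *)
Definition no_pending_call (sh : trace L) : Prop :=
  forall sigma m x s v sh', last_state sh = Some sigma ->
    (m, x, s) \in procs P -> chop sh (callREv sigma m v) sh' -> ~ wf sh'.

Inductive sched_step : sconf -> sconf -> Prop :=
| sched_local sh sh' q q' sigma k pc tau k' :
    last_state sh = Some sigma ->
    pop q = Some (q', k) ->
    (pc, tau, k') \in val sigma k ->
    consistent pc ->
    no_pending_call sh ->
    chop sh tau sh' ->
    sched_step (sh, q) (sh', push q' k')
| sched_call sh sh' q sigma m x s v y :
    (m, x, s) \in procs P ->
    last_state sh = Some sigma ->
    chop sh (callREv sigma m v) sh' ->
    wf sh' ->
    y \notin domf sigma ->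
    sched_step (sh, q)
      (rcons sh' (St sigma.[y <- v]), push q (Some (subst x y s)))
| sched_done sh q q' :
    pop q = Some (q', None) ->
    no_pending_call sh ->
    sched_step (sh, q) (sh, q')
| sched_rotate sh q q' sigma s :
    last_state sh = Some sigma ->
    pop q = Some (q', Some s) ->
    no_pending_call sh ->
    (forall pc tau k', (pc, tau, k') \in val sigma (Some s) ->
       ~~ consistent pc) ->
    sched_step (sh, q) (sh, rotate q).

(* M(q): the non-empty continuations of q, as a multiset. *)
Definition queue_pool (q : queue) : pool := seq_mset (pmap id q).

Definition program_vars : seq var :=
  stmt_vars (main P) ++
  flatten [seq d.1.2 :: stmt_vars d.2 | d <- procs P].

Definition sigma_eps : state L :=
  [fmap x : [fset x in program_vars] => zero L].

Definition init_conf : conf := ([:: St sigma_eps], [mset main P]).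
Definition init_sconf : sconf :=
  ([:: St sigma_eps], push create (Some (main P))).

(* [s] occurs in some execution of the program. [disambiguated] only ranges
   over such statements: over the whole syntax its first part would be
   contradictory, since "skip; s" and "::g; s" both continue with s. *)
Definition program_stmt (s : stmt L) : Prop :=
  exists2 C, clos_refl_trans conf step init_conf C & s \in C.2.

Definition disambiguated : Prop :=
  (forall sigma s1 s2 pc tau s1' pc' tau' s2',
     program_stmt s1 -> program_stmt s2 ->
     (pc, tau, Some s1') \in val sigma (Some s1) ->
     (pc', tau', Some s2') \in val sigma (Some s2) ->
     s1 <> s2 -> s1' <> s2') /\
  (forall sigma s pc tau s',
     program_stmt s ->
     (pc, tau, Some s') \in val sigma (Some s) ->
     ~ exists m x, (m, x, s') \in procs P).

Definition new_stmt (C C' : conf) : pool := C'.2 `\` C.2.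

(* Only membership in enabled(C) matters, which is why it is a predicate; as
   a multiset it could be infinite, step_call having infinitely many
   choices of y. *)
Definition enabled (C : conf) (s : stmt L) : Prop :=
  exists2 C', step C C' & s \in new_stmt C C'.

End Semantics.

(* Finite and infinite executions: [N] is the number of steps, [None] meaning
   infinitely many; [c i] is only relevant for i <= N. *)
Definition lt_len (i : nat) (N : option nat) : bool :=
  if N is Some n then i < n else true.
Definition le_len (i : nat) (N : option nat) : bool :=
  if N is Some n then i <= n else true.

Definition execution (T : Type) (R : T -> T -> Prop) (c0 : T)
    (N : option nat) (c : nat -> T) : Prop :=
  c 0 = c0 /\ forall i, lt_len i N -> R (c i) (c i.+1).

(* Infinite, or finite and terminating or stuck. *)
Definition complete (T : Type) (R : T -> T -> Prop)
    (N : option nat) (c : nat -> T) : Prop :=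
  if N is Some n then ~ exists C', R (c n) C' else True.

(* The finite or infinite trace produced by an execution whose successive
   finite traces are [sh i], i <= N, as a relation between positions and
   items. *)
Definition produced (L : signature) (N : option nat) (sh : nat -> trace L)
    (j : nat) (a : item L) : Prop :=
  exists2 i, le_len i N & onth (sh i) j = Some a.

Definition weakly_fair (L : signature) (P : program L)
    (N : option nat) (C : nat -> conf L) : Prop :=
  N = None ->
  forall m s, (forall n, m <= n -> enabled P (C n) s) ->
  exists2 n', m <= n' & s \in new_stmt (C n') (C n'.+1).

(* Main.v *)
(** Steps (S6) and (S7) are steps of the semantics under (sh, q) |-> (sh, M(q)),
    while (S8) and (S10) leave this abstraction unchanged; deleting the
    repetitions yields the execution C.  For fairness, let s be enabled forever.
    Only finitely many calls can be pending, so at some point none is, and s is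
    then enabled by a local step of some s1 in the queue.  As the steps other
    than (S7) pop the queue, s1 later reaches its front with no call pending,
    where s is again enabled by a local step, of some s2.  Possible continuations
    do not depend on the state, so s1 = s2 by disambiguation; hence s1 is not
    blocked, and since at most one of its branches has a consistent path
    condition, the scheduler produces s.  In the same way, if the abstraction is
    eventually constant, every queued statement reaches the front and is found
    blocked there, so that C ends in a stuck configuration. *)
Require Import Defs.
From Stdlib Require Import Relation_Operators.
From mathcomp Require Import all_boot.
From mathcomp Require Import finmap multiset boolp.

Set Implicit Arguments.
Unset Strict Implicit.
Unset Printing Implicit Defensive.

Local Open Scope nat_scope.

(** * Deleting repetitions from a sequence *)

Section Destutter.
Variables (T : Type) (A : nat -> T).

(** This is the position that [A i] gets once adjacent repetitions are deleted. *)
Definition changes (i : nat) : nat := \sum_(k < i) `[< A k.+1 <> A k >].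

Lemma changesS i : changes i.+1 = changes i + `[< A i.+1 <> A i >].
Proof. by rewrite /changes big_ord_recr. Qed.

Lemma leq_changesS i : changes i <= changes i.+1.
Proof. by rewrite changesS leq_addr. Qed.

Lemma leq_changes i j : i <= j -> changes i <= changes j.
Proof. exact: (homo_leq leqnn leq_trans leq_changesS). Qed.

(** Discrete intermediate values: the counter starts at 0 and rises by at most one per step. *)
Lemma changes_cross i j : j < changes i ->
  exists2 k, k < i & changes k = j /\ changes k.+1 = j.+1.
Proof.
elim: i => [|i IHi]; first by rewrite /changes big_ord0.
case: (ltnP j (changes i)) => [/IHi[k lt_ki ?] _|le_ij lt_ji].
  by exists k => //; exact: ltnW.
exists i => //; move: lt_ji; rewrite changesS.
case: `[< _ >]; last by rewrite addn0 ltnNge le_ij.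
by rewrite addn1 ltnS => le_ji; have -> : changes i = j by apply/eqP; rewrite eqn_leq le_ij.
Qed.

Lemma changes_const i k : i <= k -> changes i = changes k -> A i = A k.
Proof.
elim: k => [|k IHk]; first by rewrite leqn0 => /eqP->.
rewrite leq_eqVlt => /orP[/eqP-> //|le_ik] eq_f.
have eq_ik : changes i = changes k.
  by apply/eqP; rewrite eqn_leq leq_changes //= eq_f leq_changesS.
rewrite (IHk le_ik eq_ik); move: eq_f; rewrite eq_ik changesS.
case: asboolP => [_ /eqP|/contrapT //]; by rewrite -[X in X == _]addn0 eqn_add2l.
Qed.

Lemma changes_eq i k : changes i = changes k -> A i = A k.
Proof.
by move=> eq_f; case/orP: (leq_total i k) => /changes_const le_eq; last apply/esym;
  apply: le_eq.
Qed.

(** [M] is the total number of changes. For [N = None] it is infinite unless the counter attains a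
    maximum, from which point on [A] is constant. *)
Lemma destutter_length (N : option nat) : exists M : option nat,
  [/\ forall i, le_len i N -> le_len (changes i) M,
      forall j, le_len j M -> exists2 i, le_len i N & j <= changes i,
      forall n, N = Some n -> M = Some (changes n) &
      N = None -> forall m, M = Some m ->
        exists2 i0, changes i0 = m & forall i, i0 <= i -> A i = A i0].
Proof.
case: N => [n|].
  exists (Some (changes n)); split=> //= [i /leq_changes //|j le_jn|k [->] //].
  by exists n.
have [[i0 max_i0]|unbounded] := EM (exists i0, forall i, changes i <= changes i0).
  exists (Some (changes i0)); split=> //= [j le_j|_ m [<-]]; first by exists i0.
  exists i0 => // i le_i0; apply/changes_eq/eqP.
  by rewrite eqn_leq max_i0 leq_changes.
exists None; split=> //= j _.
elim: j => [|j [i _ le_ji]]; first by exists 0.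
apply: contrapT => no_i; apply: unbounded; exists i => k.
rewrite leqNgt; apply/negP => lt_ik; apply: no_i; exists k => //.
exact: leq_ltn_trans lt_ik.
Qed.

Lemma le_len_trans i j N : i <= j -> le_len j N -> le_len i N.
Proof. by case: N => //= n; apply: leq_trans. Qed.

Lemma destutter (R : T -> T -> Prop) (N : option nat) :
  (forall i, lt_len i N -> A i = A i.+1 \/ R (A i) (A i.+1)) ->
  exists (M : option nat) (C : nat -> T),
  [/\ execution R (A 0) M C,
      forall i, le_len i N -> le_len (changes i) M /\ C (changes i) = A i,
      forall j, le_len j M -> exists2 i, le_len i N & j = changes i,
      forall n, N = Some n -> M = Some (changes n) &
      N = None -> forall m, M = Some m ->
        exists2 i0, changes i0 = m & forall i, i0 <= i -> A i = A i0].
Proof.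
move=> stepA; have [M [le_M le_N MSome MNone]] := destutter_length N.
(* [C j] is the common value of [A] on the indices where the counter equals [j]; a value [j] that is
   never attained gets the junk [A 0]. *)
have /choice[C CP] : forall j, exists c, forall i, changes i = j -> c = A i.
  move=> j; have [[i eq_ij]|no_i] := EM (exists i, changes i = j).
    by exists (A i) => k eq_kj; apply: changes_eq; rewrite eq_ij.
  by exists (A 0) => i eq_ij; case: no_i; exists i.
exists M, C; split=> //.
- split=> [|j lt_jM]; first by apply: CP; rewrite /changes big_ord0.
  (* Step [j] of [C] is the step of [A] at which the counter passes from [j] to [j.+1]. *)
  have {lt_jM}/le_N[i le_iN /changes_cross[k lt_ki [eq_k eq_kS]]] : le_len j.+1 M.
    by case: (M) lt_jM.
  rewrite (CP _ _ eq_k) (CP _ _ eq_kS).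
  have lt_kN : lt_len k N by case: (N) le_iN => //= n; apply: leq_trans.
  case: (stepA k lt_kN) => // eq_A; move: eq_kS.
  rewrite changesS eq_k; case: asboolP => [[] //|_ /eqP].
  by rewrite addn0 ltn_eqF.
- by move=> i le_iN; split; [exact: le_M | exact: CP].
- move=> j /[dup] le_jM /le_N[i le_iN]; rewrite leq_eqVlt => /orP[/eqP->|].
    by exists i.
  case/changes_cross=> k lt_ki [<- _]; exists k => //.
  exact: le_len_trans (ltnW lt_ki) le_iN.
Qed.

End Destutter.

(** * Local evaluation of statements *)

Section Local.
Variable L : signature.
Implicit Types (s : stmt L) (sigma : state L) (k : cont L).

Fixpoint stmt_size s : nat :=
  match s with
  | Skip _ | Assign _ _ _ | Spawn _ _ _ => 1
  | If _ _ s | While _ _ s | Guard _ _ s => (stmt_size s).+1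
  | Seq s1 s2 => (stmt_size s1 + stmt_size s2).+1
  end.

(** Both branches of a conditional are listed whatever its test yields, so the state affects only
    path conditions and traces. *)
Lemma val_stmt_conts sigma sigma' s :
  [seq i.2 | i <- val_stmt sigma s] = [seq i.2 | i <- val_stmt sigma' s].
Proof.
elim: s => //= s1 IH s2 _.
have conts_seq (l : seq (pathcond * trace L * cont L)) :
    [seq i.2 | i <- [seq (i.1, seq_cont i.2 s2) | i <- l]] =
    [seq seq_cont k s2 | k <- [seq i.2 | i <- l]] by rewrite -!map_comp.
by rewrite !conts_seq IH.
Qed.

Lemma val_stmt_state sigma sigma' s pc tau k :
  (pc, tau, k) \in val_stmt sigma s ->
  exists pc' tau', (pc', tau', k) \in val_stmt sigma' s.
Proof.
move=> /(map_f snd); rewrite (val_stmt_conts _ sigma') => /mapP[[[pc' tau'] k']].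
by move=> in_s /= ->; exists pc', tau'.
Qed.

Lemma consistent1 b : consistent [fset b]%fset = b.
Proof. by rewrite /consistent in_fset1; case: b. Qed.

(** Two items arise only from conditionals and loops, and their path conditions are
    complementary. *)
Lemma val_stmt_det sigma s pc tau k pc' tau' k' :
  (pc, tau, k) \in val_stmt sigma s -> (pc', tau', k') \in val_stmt sigma s ->
  consistent pc -> consistent pc' -> k = k'.
Proof.
have val_ifP b s1 pc1 tau1 k1 pc2 tau2 k2 : (pc1, tau1, k1) \in val_if sigma b s1 ->
    (pc2, tau2, k2) \in val_if sigma b s1 ->
    consistent pc1 -> consistent pc2 -> k1 = k2.
  rewrite /val_if !inE => /orP[]/eqP[-> _ ->] /orP[]/eqP[-> _ ->] //;
  by rewrite !consistent1 /=; case: beval.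
elim: s pc tau k pc' tau' k' => /= [t|t x e|t b s _|s1 IH s2 _|t b s _|t m e|t b s _]
  pc tau k pc' tau' k'; try exact: val_ifP; rewrite ?inE;
  try by move=> /eqP[_ _ ->] /eqP[_ _ ->].
move=> /mapP[[[pc1 tau1] k1] in1 /= [-> _ ->]].
move=> /mapP[[[pc2 tau2] k2] in2 /= [-> _ ->]] c1 c2.
by rewrite (IH _ _ _ _ _ _ in1 in2).
Qed.

(** This makes the chop of the current trace with a local trace defined. *)
Lemma val_stmt_head sigma s pc tau k :
  (pc, tau, k) \in val_stmt sigma s -> exists tau', tau = St sigma :: tau'.
Proof.
have val_ifP b s1 pc' tau' k' : (pc', tau', k') \in val_if sigma b s1 ->
    exists tau1, tau' = St sigma :: tau1.
  by rewrite /val_if !inE => /orP[]/eqP[_ -> _]; exists [::].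
elim: s pc tau k => /= [t|t x e|t b s _|s1 IH s2 _|t b s _|t m e|t b s _] pc tau k;
  try exact: val_ifP; rewrite ?inE;
  try by move=> /eqP[_ -> _]; eexists.
by move=> /mapP[[[pc1 tau1] k1] /IH ? /= [_ -> _]].
Qed.

(** Hence a local step always changes the pool. Size does not settle every case, since unrolling a
    loop enlarges it; but a [Seq] is not a [While], and below [Seq] the induction hypothesis
    applies. *)
Lemma val_stmt_neq sigma s pc tau s' :
  (pc, tau, Some s') \in val_stmt sigma s -> s' <> s.
Proof.
have size_neq s1 s2 : stmt_size s1 < stmt_size s2 -> s1 <> s2.
  by move=> lt_s eq_s; move: lt_s; rewrite eq_s ltnn.
elim: s pc tau s' => /= [t|t x e|t b s _|s1 IH s2 _|t b s _|t m e|t b s _] pc tau s';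
  rewrite /val_if ?inE; try by move=> /eqP.
- by case/orP=> /eqP[] // _ _ ->; apply: size_neq.
- move=> /mapP[[[pc1 tau1] [r|]] in1 /= [_ _ ->]]; first by case=> /IH; apply; exact: in1.
  by apply: size_neq; rewrite /= ltnS leq_addl.
- by case/orP=> /eqP[] // _ _ ->.
- by move=> /eqP[] _ _ ->; apply: size_neq.
Qed.
End Local.

(** * Queues as multisets of continuations *)

Section Scheduler.
Variables (L : signature) (P : program L).
Implicit Types (sh tau : trace L) (sigma : state L) (c : sconf L) (s : stmt L).

Definition abs_conf c : conf L := (c.1, queue_pool c.2).

Lemma last_state_rcons sh sigma :
  last_state sh = Some sigma -> exists sh', sh = rcons sh' (St sigma).
Proof.
case/lastP: sh => // sh a; rewrite /last_state rev_rcons /=.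
by case: a => // sigma' [->]; exists sh.
Qed.

Lemma last_state_chop sh sigma tau : last_state sh = Some sigma ->
  exists sh', chop sh (St sigma :: tau) sh'.
Proof. by move=> /last_state_rcons[sh' ->]; eexists; apply: Chop. Qed.

Lemma mset1E (K : choiceType) (a b : K) : ([mset a] b = (b == a))%mset.
Proof. by rewrite msetnE; case: eqP. Qed.

Lemma in_queue_pool (q : queue L) s : (s \in queue_pool q) = (Some s \in q).
Proof.
by rewrite /queue_pool (perm_mem (perm_eq_seq_mset _)) mem_pmap map_id.
Qed.

Lemma queue_pool_cons s (q : queue L) :
  queue_pool (Some s :: q) = (queue_pool q `+` [mset s])%mset.
Proof.
by apply/msetP => s'; rewrite msetE2 mset1E !mset_seqE /= addnC eq_sym.
Qed.

Lemma queue_pool_push (q : queue L) (k : cont L) :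
  queue_pool (push q k) = pool_add (queue_pool q) k.
Proof.
apply/msetP => s; case: k => [s'|] /=;
  rewrite ?msetE2 ?mset1E !mset_seqE /push -cats1 pmap_cat ?cats0 //=.
by rewrite count_cat /= addn0 eq_sym.
Qed.

Lemma new_stmt_push (p : pool L) sh sh' s s' : s' <> s ->
  s' \in new_stmt (sh, p `+` [mset s])%mset (sh', p `+` [mset s'])%mset.
Proof.
move=> /eqP neq_s; rewrite /new_stmt msetBDl.
by rewrite in_msetB !mset1E eqxx (negPf neq_s).
Qed.

(** * Counting calls and their starts *)

Definition is_call (a : item L) := if a is CallEv _ _ then true else false.
Definition is_callR (a : item L) := if a is CallREv _ _ then true else false.
Definition call_of (a : item L) := if a is CallREv m v then CallEv m v else a.

Lemma wf_count sh : wf sh -> forall m v,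
  count_mem (CallREv m v) sh <= count_mem (CallEv m v) sh.
Proof.
elim=> [//|sh' sigma _ IH|sh' m v _ IH|sh' m v _ IH lt_c] m' v';
  rewrite -!cats1 !count_cat /= !addn0.
- by do 2!case: eqP => // _; rewrite !addn0.
- by case: eqP => // _; rewrite addn0 (leq_trans (IH _ _)) ?leq_addr.
case: eqP => [[<- <-]|_]; case: eqP => // _; rewrite !addn0 //.
by rewrite addn1.
Qed.

(** This sums [wf_count] over all calls: mapped by [call_of], the start events are, up to
    permutation, a subsequence of the call events. *)
Lemma wf_leq_calls sh : wf sh -> count is_callR sh <= count is_call sh.
Proof.
move=> /wf_count le_calls.
have /count_subseqP[s sub_s /perm_size] :
    forall a, count_mem a (map call_of (filter is_callR sh)) <=
              count_mem a (filter is_call sh).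
  move=> a; rewrite count_map !count_filter.
  case: a => [sigma|m v|m v].
  - rewrite (eq_count (a2 := pred0)) ?count_pred0 // => -[?|? ?|? ?] /=;
    by rewrite ?andbF ?andbT //; apply/eqP.
  - have eq_callR : predI (preim call_of (pred1 (CallEv m v))) is_callR =1
        pred1 (CallREv m v).
      move=> -[?|? ?|? ?] /=; rewrite ?andbT ?andbF; try by apply/esym/eqP.
      by apply/eqP/eqP => -[-> ->].
    have eq_call : predI (pred1 (CallEv m v)) is_call =1 pred1 (CallEv m v).
      by move=> -[?|? ?|? ?] /=; rewrite ?andbT ?andbF //; apply/esym/eqP.
    by rewrite (eq_count eq_callR) (eq_count eq_call).
  - rewrite (eq_count (a2 := pred0)) ?count_pred0 // => -[?|? ?|? ?] /=;
    by rewrite ?andbF ?andbT //; apply/eqP.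
rewrite size_map size_filter => ->.
by rewrite -size_filter size_subseq.
Qed.

(** A measure bounding the number of consecutive (S7) steps; by [wf_leq_calls] the truncated
    subtraction is exact on well-formed traces. *)
Definition pending sh := count is_call sh - count is_callR sh.

Lemma chop_inv sh tau sh' : chop sh tau sh' ->
  exists t sigma, sh = rcons t (St sigma) /\ sh' = t ++ tau.
Proof. by case=> t sigma *; exists t, sigma. Qed.

(** Well-formedness after the start event means that a call was left to start, so the subtraction
    was not yet truncated at 0. *)
Lemma pending_call sh sigma m v sh' sigma' :
  chop sh (callREv sigma m v) sh' -> wf sh' ->
  pending (rcons sh' (St sigma')) < pending sh.
Proof.
move=> /chop_inv[t [sigma0 [-> ->]]] /wf_leq_calls.
rewrite /pending -!cats1 !count_cat /= !addn0 => le_calls.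
by apply: ltn_sub2l; move: le_calls; rewrite add0n addn1.
Qed.

(** * Scheduler steps seen in the semantics *)

Lemma step_abs c c' : sched_step P c c' ->
  abs_conf c = abs_conf c' \/ step P (abs_conf c) (abs_conf c').
Proof.
case=> [sh sh' q q' sigma [s|//] pc tau k last_sh|sh sh' q sigma m x s v y
  |sh q q'|sh q q' sigma s _].
- case: q => [//|_ _] [-> ->] in_s ok_pc _ chop_sh; right.
  rewrite /abs_conf /= queue_pool_cons queue_pool_push.
  exact: step_local last_sh in_s ok_pc chop_sh.
- move=> in_P last_sh chop_sh wf_sh fresh_y; right.
  by rewrite /abs_conf /= queue_pool_push; exact: step_call in_P last_sh chop_sh wf_sh fresh_y.
- by case: q => [//|_ _] [-> ->] _; left.
- case: q => [//|_ _] [-> ->] _ _; left.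
  by rewrite /abs_conf /rotate /= queue_pool_cons queue_pool_push.
Qed.

(* The stuttering steps of the scheduler are (S8) and (S10). *)
Lemma step_stutter c c' : sched_step P c c' -> abs_conf c = abs_conf c' ->
  no_pending_call P c.1 /\
  forall s q, c.2 = Some s :: q -> forall sigma pc tau k,
    last_state c.1 = Some sigma -> (pc, tau, k) \in Defs.val sigma (Some s) ->
    ~~ consistent pc.
Proof.
case=> [sh sh' q q' sigma [s|//] pc tau k last_sh
  |sh sh' q sigma m x s v y _ _ _ _ _|sh q q'|sh q q' sigma s].
- case: q => [//|_ _] [-> ->] in_s _ _ _ [_].
  (* (S6) never stutters: it removes one copy of [s], and its continuation is not [s]. *)
  rewrite queue_pool_cons queue_pool_push => /msetP/(_ s).
  case: k in_s => [s'|] in_s /=; rewrite ?msetE2 !mset1E eqxx.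
    have /eqP/negPf neq_s := val_stmt_neq in_s.
    by rewrite eq_sym neq_s => /eqP; rewrite eqn_add2l.
  by rewrite addn1 => /eqP; rewrite gtn_eqF.
- case=> _; rewrite queue_pool_push => /msetP/(_ (subst x y s)).
  by rewrite /= msetE2 mset1E eqxx addn1 => /eqP; rewrite ltn_eqF.
- by case: q => [//|_ _] [-> ->] no_call _.
- case: q => [//|_ _] last_sh [-> ->] no_call stuck _; split=> //= s' q'' [<- _].
  by move=> sigma' pc tau k; rewrite last_sh => -[<-]; apply: stuck.
Qed.

Lemma fresh_var sigma : exists y, y \notin domf sigma.
Proof.
exists (\max_(x <- domf sigma) x).+1; apply/negP => /(@leq_bigmax_seq _ _ xpredT id).
by move=> /(_ isT); rewrite ltnn.
Qed.

Lemma call_or_no_pending sh (q : queue L) :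
  no_pending_call P sh \/ exists c', sched_step P (sh, q) c'.
Proof.
have [?|no_step] := EM (exists c', sched_step P (sh, q) c'); [by right|left].
move=> sigma m x s v sh' last_sh in_P chop_sh wf_sh; apply: no_step.
have [y fresh_y] := fresh_var sigma.
by eexists; apply: sched_call in_P last_sh chop_sh wf_sh fresh_y.
Qed.

(** With no call pending, any front element allows (S6), (S8) or (S10), so a stuck scheduler has an
    empty queue and no call to start. *)
Lemma stuck_abs c : (~ exists c', sched_step P c c') ->
  ~ exists C', step P (abs_conf c) C'.
Proof.
case: c => sh q stuck [C']; have [no_call|//] := call_or_no_pending sh q.
rewrite /abs_conf /=; move eq_C: (sh, queue_pool q) => C step_C.
case: step_C eq_C.
- move=> sh1 sh' p sigma s pc tau k last_sh in_s ok_pc chop_sh [eq_sh eq_p].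
  rewrite -{}eq_sh in last_sh chop_sh.
  apply: stuck; case: q eq_p => [/msetP/(_ s)|[s'|] q _].
  + by rewrite msetE2 mset1E eqxx addn1 mset_seqE.
  + have [[i in_s' ok_i]|no_i] :=
      EM (exists2 i, i \in Defs.val sigma (Some s') & consistent i.1.1).
      case: i in_s' ok_i => [[pc1 tau1] k1] in_s' ok_i.
      have [tau' eq_tau] := val_stmt_head in_s'.
      have [sh1' chop_sh'] := last_state_chop tau' last_sh.
      rewrite -eq_tau in chop_sh'.
      eexists; exact: (@sched_local _ _ sh _ (Some s' :: q) q)
        last_sh erefl in_s' ok_i no_call chop_sh'.
    eexists; apply: (@sched_rotate _ _ sh (Some s' :: q) q) last_sh erefl no_call _.
    by move=> pc1 tau1 k1 in_s'; apply/negP => ok_pc1; apply: no_i; exists (pc1, tau1, k1).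
  + by eexists; apply: (@sched_done _ _ sh (None :: q) q).
- move=> sh1 sh' p sigma m x s v y in_P last_sh chop_sh wf_sh fresh_y [eq_sh _].
  by apply: (no_call sigma m x s v sh') => //; rewrite eq_sh.
Qed.

(** * Infinite scheduler executions *)

Section InfiniteExecution.
Variable D : nat -> sconf L.
Hypothesis stepD : forall i, sched_step P (D i) (D i.+1).

(** While a call is pending only (S7) can fire, and it lowers [pending]. *)
Lemma eventually_no_pending i : exists2 j, i <= j & no_pending_call P (D j).1.
Proof.
have [n] := ubnP (pending (D i).1); elim: n i => // n IHn i lt_n.
have [no_call|call] := EM (no_pending_call P (D i).1); first by exists i.
have lt_pend : pending (D i.+1).1 < pending (D i).1.
  case: (stepD i) call => // sh sh' q sigma m x s v y _ _ chop_sh wf_sh _ _.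
  exact: pending_call chop_sh wf_sh.
have [|j /ltnW le_ij no_call] := IHn i.+1; first exact: leq_trans lt_pend _.
by exists j.
Qed.

(* While calls are pending, steps leave the position of [s] in the queue
   unchanged; otherwise they decrease it, unless [s] is at the front. *)
Lemma eventually_head i s : Some s \in (D i).2 ->
  exists2 j, i <= j & no_pending_call P (D j).1 /\ exists q, (D j).2 = Some s :: q.
Proof.
(* Lexicographic induction: on the index of [s], then on [pending], which may grow again when the
   index drops. *)
have [n] := ubnP (index (Some s) (D i).2).
elim: n i => // n IHn i; have [m] := ubnP (pending (D i).1).
elim: m i => // m IHm i lt_m lt_n in_q.
have [no_call|call] := EM (no_pending_call P (D i).1); last first.
  have [|||j /ltnW le_ij jP] := IHm i.+1; last by exists j.
  - case: (stepD i) call lt_m => // sh sh' q sigma m0 x s0 v y _ _ chop_sh wf_sh _ _.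
    by rewrite ltnS; apply: leq_trans; exact: pending_call chop_sh wf_sh.
  - case: (stepD i) call lt_n in_q => //= sh sh' q sigma m0 x s0 v y _ _ _ _ _ _.
    by rewrite /push -cats1 index_cat => lt_n ->.
  - case: (stepD i) call in_q => //= sh sh' q sigma m0 x s0 v y _ _ _ _ _ _.
    by rewrite /push mem_rcons inE orbC => ->.
have [[q eq_q]|not_head] := EM (exists q, (D i).2 = Some s :: q).
  by exists i => //; split=> //; exists q.
have [k [q [q' [eq_q eq_q']]]] : exists k q q', (D i).2 = k :: q /\ (D i.+1).2 = q ++ q'.
  case: (stepD i) no_call => /=.
  - move=> sh sh' q q' sigma k pc tau k' _; case: q => // k1 q [-> ->] _ _ _ _ _.
    by exists k, q', [:: k']; rewrite /push cats1.
  - move=> sh sh' q sigma m0 x s0 v y in_P last_sh chop_sh wf_sh _.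
    by move=> /(_ _ _ _ _ _ _ last_sh in_P chop_sh).
  - by move=> sh q q'; case: q => // k1 q [-> ->] _ _; exists None, q', [::]; rewrite cats0.
  - move=> sh q q' sigma s0 _; case: q => // k1 q [-> ->] _ _ _.
    by exists (Some s0), q', [:: Some s0]; rewrite /rotate /push /= cats1.
have neq_k : k != Some s by apply/eqP => eq_k; apply: not_head; exists q; rewrite eq_q eq_k.
move: lt_n in_q; rewrite eq_q /= (negPf neq_k) inE eq_sym (negPf neq_k) /= => lt_n in_q.
have [||j /ltnW le_ij jP] := IHn i.+1; last by exists j.
- by rewrite eq_q' index_cat in_q.
- by rewrite eq_q' mem_cat in_q.
Qed.

(** The trace, hence its last state, stays fixed. A statement able to step would reach the front
    still able to, yet a stuttering step there needs it blocked. *)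
Lemma eventually_stutter_stuck i0 :
  (forall i, i0 <= i -> abs_conf (D i) = abs_conf (D i0)) ->
  ~ exists C', step P (abs_conf (D i0)) C'.
Proof.
move=> const [C']; move eq_C: (abs_conf (D i0)) => C step_C.
have stutter i : i0 <= i -> abs_conf (D i) = abs_conf (D i.+1).
  by move=> le_i; rewrite !const // leqW.
case: step_C eq_C.
- move=> sh sh' p sigma s pc tau k last_sh in_s ok_pc _ eq_C.
  have /eventually_head[j le_j [_ [q eq_q]]] : Some s \in (D i0).2.
    by rewrite -in_queue_pool; case: eq_C => _ ->; rewrite in_msetD mset11 orbT.
  have [_ /(_ _ _ eq_q sigma pc tau k)] := step_stutter (stepD j) (stutter _ le_j).
  have -> : (D j).1 = sh by case: (const _ le_j) => -> _; case: eq_C.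
  by rewrite ok_pc => /(_ last_sh in_s).
- move=> sh sh' p sigma m x s v y in_P last_sh chop_sh wf_sh _ [eq_sh _].
  have [no_call _] := step_stutter (stepD i0) (stutter _ (leqnn _)).
  by apply: (no_call sigma m x s v sh') => //; rewrite eq_sh.
Qed.

Lemma enabled_local (C : conf L) s : no_pending_call P C.1 -> enabled P C s ->
  exists s1 sigma pc tau, [/\ s1 \in C.2, last_state C.1 = Some sigma,
    (pc, tau, Some s) \in Defs.val sigma (Some s1) & consistent pc].
Proof.
move=> no_call [C' step_C]; case: step_C no_call => /=.
  move=> sh sh' p sigma s1 pc tau k last_sh in_s1 ok_pc _ _ in_new.
  exists s1, sigma, pc, tau; split=> //; first by rewrite in_msetD mset11 orbT.
  (* The difference of the two pools can contain nothing but the continuation [k]. *)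
  suff -> : Some s = k by [].
  case: k in_new {in_s1} => [s'|] /=; rewrite /new_stmt in_msetB !msetE2 !mset1E.
    by rewrite ltn_add2l; case: (s =P s') => [->|_] //; case: (s == s1).
  by rewrite ltnNge leq_addr.
move=> sh sh' p sigma m x s0 v y in_P last_sh chop_sh wf_sh _.
by move=> /(_ _ _ _ _ _ _ last_sh in_P chop_sh).
Qed.

Hypothesis reachD : forall i, clos_refl_trans _ (step P) (init_conf P) (abs_conf (D i)).
Hypothesis disP : disambiguated P.

Lemma sched_fair i s : (forall j, i <= j -> enabled P (abs_conf (D j)) s) ->
  exists2 j, i <= j & s \in new_stmt (abs_conf (D j)) (abs_conf (D j.+1)).
Proof.
move=> enabled_s; have [i0 le_i0 no_call] := eventually_no_pending i.
have [s1 [sigma0 [pc0 [tau0 [in_s1 _ val_s1 _]]]]] :=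
  enabled_local (C := abs_conf (D i0)) no_call (enabled_s _ le_i0).
move: in_s1; rewrite in_queue_pool => /eventually_head[j le_j [{}no_call [q eq_q]]].
have le_ij := leq_trans le_i0 le_j; exists j => //.
have [s2 [sigma [pc [tau [in_s2 last_j val_s2 ok_pc]]]]] :=
  enabled_local (C := abs_conf (D j)) no_call (enabled_s _ le_ij).
(* Disambiguation compares items evaluated in one state, so the item of [s1] is moved to the state
   at [j]. *)
have [pc1 [tau1 val_s1j]] := val_stmt_state sigma val_s1.
have eq_s : s1 = s2.
  apply: contrapT => /(disP.1 _ _ _ _ _ _ _ _ _ _ _ val_s1j val_s2) neq_s; apply: neq_s => //.
    by exists (abs_conf (D j)) => //; rewrite in_queue_pool eq_q mem_head.
  by exists (abs_conf (D j)).
rewrite -eq_s in val_s2 => {s2 eq_s in_s2 val_s1 val_s1j}.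
(* An unblocked statement at the front and no pending call leave only (S6), and [val_stmt_det]
   forces its continuation to be [s]. *)
case: (stepD j) no_call eq_q last_j => /=.
- move=> sh sh' q1 q2 sigma' k pc2 tau2 k' last_sh; case: q1 => [//|_ _] [-> ->].
  move=> val_k ok_pc2 _ _ _ [eq_k _]; rewrite last_sh => -[eq_sigma].
  move: val_k; rewrite eq_k eq_sigma => val_k.
  have := val_stmt_det val_s2 val_k ok_pc ok_pc2 => <-.
  rewrite /abs_conf /= queue_pool_cons queue_pool_push /=.
  exact/new_stmt_push/(val_stmt_neq val_s2).
- move=> sh sh' q1 sigma' m x s0 v y in_P last_sh chop_sh wf_sh _.
  by move=> /(_ _ _ _ _ _ _ last_sh in_P chop_sh).
- by move=> sh q1 q2; case: q1 => [//|_ _] [-> ->] _ _ [].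
- move=> sh q1 q2 sigma' s0 last_sh; case: q1 => [//|_ _] [-> ->] _ stuck _ [eq_s0 _].
  rewrite last_sh => -[eq_sigma]; move: val_s2; rewrite -eq_s0 -eq_sigma => /stuck.
  by rewrite ok_pc.
Qed.
End InfiniteExecution.
End Scheduler.

(** * Transfer to the execution of the semantics *)

Lemma execution_reach (T : Type) (R : T -> T -> Prop) c0 N c i :
  execution R c0 N c -> le_len i N -> clos_refl_trans T R c0 (c i).
Proof.
case=> <- stepc; elim: i => [_|i IHi le_i]; first exact: rt_refl.
have lt_i : lt_len i N by case: (N) le_i.
apply: rt_trans (IHi _) (rt_step _ _ _ _ (stepc _ lt_i)).
exact: le_len_trans (leqnSn i) le_i.
Qed.

(* [D] is the scheduler execution and [C] the execution of the semantics;
   [f i] is the position in [C] of the i-th scheduler configuration, so that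
   C (f i) ->* C (f i.+1), and [C] consists of exactly these segments. *)
Theorem mainTheorem3 (L : signature) (P : program L) (hP : disambiguated P)
    (N : option nat) (D : nat -> sconf L)
    (hD : execution (sched_step P) (init_sconf P) N D) :
  exists (M : option nat) (C : nat -> conf L) (f : nat -> nat),
    execution (step P) (init_conf P) M C /\
    weakly_fair P M C /\
    (complete (sched_step P) N D -> complete (step P) M C) /\
    f 0 = 0 /\
    (forall i, lt_len i N -> f i <= f i.+1) /\
    (forall i, le_len i N ->
       le_len (f i) M /\ C (f i) = ((D i).1, queue_pool (D i).2)) /\
    (forall j, le_len j M -> exists2 i, le_len i N & j <= f i) /\
    (forall j a, produced M (fun i => (C i).1) j a <->
                 produced N (fun i => (D i).1) j a).
Proof.
case: hD => D0 stepD.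
have stepA i : lt_len i N -> abs_conf (D i) = abs_conf (D i.+1) \/
    step P (abs_conf (D i)) (abs_conf (D i.+1)) by move=> /stepD/step_abs.
have [M [C [exC CP le_M MSome MNone]]] := destutter stepA.
have eq_A0 : abs_conf (D 0) = init_conf P.
  rewrite D0 /abs_conf /init_sconf /= (queue_pool_push [::]) /= /queue_pool.
  by congr pair; apply/msetP => s; rewrite msetE2 mset_seqE.
rewrite eq_A0 in exC.
exists M, C, (changes (fun i => abs_conf (D i))); split; first exact: exC.
split.
  move=> M_None m s enabled_s.
  have N_None : N = None by case: (N) MSome => // n /(_ _ erefl); rewrite M_None.
  have {}CP i : C (changes (fun i => abs_conf (D i)) i) = abs_conf (D i).
    by apply: (CP i _).2; rewrite N_None.
  (* Position [m] of [C] comes from some index [i] of [D], so [s] is enabled from [i] on in [D]. *)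
  have [|i _ eq_m] := le_M m; first by rewrite M_None.
  have stepD' k : sched_step P (D k) (D k.+1) by apply: stepD; rewrite N_None.
  have reachD k : clos_refl_trans _ (step P) (init_conf P) (abs_conf (D k)).
    by rewrite -CP; apply: execution_reach exC _; rewrite M_None.
  have [|j le_j in_new] := @sched_fair _ _ D stepD' reachD hP i s.
    by move=> k le_k; rewrite -CP; apply: enabled_s; rewrite eq_m leq_changes.
  exists (changes (fun i => abs_conf (D i)) j); first by rewrite eq_m leq_changes.
  (* Something new appears at step [j], so it is no stutter and [D j.+1] lies at the next position
     of [C]. *)
  suff <- : changes (fun i => abs_conf (D i)) j.+1 =
      (changes (fun i => abs_conf (D i)) j).+1 by rewrite !CP.
  rewrite changesS; case: asboolP => [_|/contrapT eq_D]; first by rewrite addn1.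
  by move: in_new; rewrite eq_D in_msetB ltnn.
split.
  case eq_N: N => [n|] /=.
    move=> /stuck_abs; rewrite (MSome _ eq_N) /=.
    by rewrite (CP n _).2 // eq_N /=.
  (* An infinite [D] may yield a finite [C], which then ends where the abstraction of [D] becomes
     constant. *)
  move=> _; case eq_M: M => [m|//] /=.
  have [i0 <- const] := MNone eq_N _ eq_M; rewrite (CP i0 _).2 ?eq_N //.
  by apply: eventually_stutter_stuck => // i; apply: stepD; rewrite eq_N.
split; first by rewrite /changes big_ord0.
split; first by move=> i _; exact: leq_changesS.
split; first exact: CP.
split; first by move=> j /le_M[i le_i ->]; exists i.
move=> j a; split=> [[k /le_M[i le_i ->]]|[i /[dup] le_i /CP[le_C eq_C] eq_a]].
  by rewrite (CP _ le_i).2 => ?; exists i.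
by exists (changes (fun i => abs_conf (D i)) i) => //; rewrite eq_C.
Qed.
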